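(* Let $w$ be a perfectly clustering word over a totally ordered alphabet, and let $a_1\pi_1a_2\pi_2\cdots\pi_{k-1}a_k$ be the palindromic special factorization of the Lyndon conjugate of $w$. Then for any two consecutive rows of the Burrows–Wheeler matrix of $w$, viewed as words $w'$ (upper row) and $w''$ (next row), there exist words $x,y,m$ such that $w'=ymx$, $w''=y\tilde m x$, and $xy\in\{\pi_1,\dots,\pi_{k-1}\}$.
   Context: $\tilde m$ denotes the reversal of the word $m$. A special factorization of a word $v$ is a factorization $v=a_1\pi_1a_2\cdots\pi_{k-1}a_k$ where the set of letters occurring in $v$ is $\{a_1<\cdots<a_k\}$ and $\pi_1,\dots,\pi_{k-1}$ are words; it is palindromic if every $\pi_i$ is a palindrome. Lexicographic order: a proper prefix is smaller. A Lyndon word is a primitive word strictly smaller than its other conjugates. For a primitive word $v$ of length $n$ with conjugates $v_1<\cdots<v_n$, $\mathrm{bw}(v)$ is the word formed by the last letters of $v_1,\dots,v_n$; $v$ is perfectly clustering if it is primitive and $\mathrm{bw}(v)$ is weakly decreasing. The Burrows–Wheeler matrix of $v$ has as rows the conjugates $v_1,\dots,v_n$ in this order. The Lyndon conjugate of a perfectly clustering word is perfectly clustering and has a unique palindromic special factorization. *)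

(* Defs.v *)
From mathcomp Require Import all_boot all_order.
Set Implicit Arguments. Unset Strict Implicit. Unset Printing Implicit Defensive.
Import Order.TTheory.
Local Open Scope order_scope.

Section Words.
Context {d : Order.disp_t} {T : orderType d}.

Fixpoint lexlt (u v : seq T) : bool :=
  match u, v with
  | [::], [::] => false
  | [::], _ :: _ => true
  | _ :: _, [::] => false
  | a :: u', b :: v' => (a < b) || ((a == b) && lexlt u' v')
  end.

Definition lexle (u v : seq T) : bool := (u == v) || lexlt u v.

(* v is primitive: not a power u^k with k >= 2 (so the empty word is not primitive). *)
Definition primitive (v : seq T) : Prop :=
  ~ exists (u : seq T) (k : nat), 1 < k /\ v = flatten (nseq k u).

Definition conjugates (v : seq T) : seq (seq T) := [seq rot i v | i <- iota 0 (size v)].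

Definition lyndon (v : seq T) : Prop :=
  primitive v /\ forall u, u \in conjugates v -> u != v -> lexlt v u.

Definition bwrows (v : seq T) : seq (seq T) := sort lexle (conjugates v).

Definition bw (v : seq T) : seq T := pmap (fun u => ohead (rev u)) (bwrows v).

Definition perfectly_clustering (v : seq T) : Prop :=
  primitive v /\ sorted (fun a b => b <= a) (bw v).

Fixpoint interleave (as_ : seq T) (ps : seq (seq T)) : seq T :=
  match as_, ps with
  | a :: as', p :: ps' => a :: p ++ interleave as' ps'
  | _, _ => as_
  end.

Definition special_factorization (v : seq T) (as_ : seq T) (ps : seq (seq T)) : Prop :=
  [/\ as_ != [::], sorted <%O as_, (forall c, (c \in v) = (c \in as_)),
      size ps = (size as_).-1 & v = interleave as_ ps].

Definition palindromic_special_factorization (v : seq T) as_ ps : Prop :=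
  special_factorization v as_ ps /\ all (fun p => p == rev p) ps.

End Words.

(* Main.v *)
(** Number the rows of the Burrows-Wheeler matrix 0, ..., n-1 and let [step] send
    a row to its rotation by one letter.  Since the last column is decreasing,
    [step] is a discrete interval exchange reversing the order of the blocks of
    rows with a common first letter, and the reflection [i |-> n-1-i]
    conjugates it to its inverse, so that reversing a word reflects its row.
    As [pi_h] is a palindrome preceded by [a_h] and followed by [a_(h+1)] in a
    conjugate, reversal yields two rows that begin with [pi_h] and end with
    [a_(h+1)] and [a_h]; between them lie two consecutive rows [c_h], [c_h + 1]
    at which the last column drops from [a_(h+1)] to [a_h], and these stay
    adjacent along [pi_h].  The pairs of adjacent rows obtained in this way
    are distinct and number [n - 1], so they are all the pairs.  Hence the
    pair leaving [pi_h] is split by [step], which locates it at the reflection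
    of the pair [c_h], and this forces the rests of the two rows after [pi_h]
    to be reversals of each other. *)
Require Import Defs.
From mathcomp Require Import all_boot all_order.
From mathcomp Require Import zify.
Set Implicit Arguments. Unset Strict Implicit. Unset Printing Implicit Defensive.
Import Order.TTheory.

(** * Lexicographic order on words *)

Section LexOrder.
Context {d : Order.disp_t} {T : orderType d}.
Implicit Types u v w : seq T.

Lemma lexlt_irr : irreflexive (@lexlt d T).
Proof. by elim=> //= a u ->; rewrite ltxx eqxx. Qed.

Lemma lexlt_trans : transitive (@lexlt d T).
Proof.
move=> v u w; elim: u v w => [|a u IHu] [|b v] [|c w] //=.
case/orP=> [ab|/andP[/eqP-> uv]]; case/orP=> [bc|/andP[/eqP<- vw]].
- by rewrite (lt_trans ab bc).
- by rewrite ab.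
- by rewrite bc.
- by rewrite eqxx (IHu _ _ uv vw) orbT.
Qed.

Lemma lexle_trans : transitive (@lexle d T).
Proof.
move=> v u w; rewrite /lexle => /orP[/eqP->//|uv] /orP[/eqP<-|vw].
  by rewrite uv orbT.
by rewrite (lexlt_trans uv vw) orbT.
Qed.

Lemma lexle_total : total (@lexle d T).
Proof.
rewrite /lexle; elim=> [|a u IHu] [|b v] //=.
rewrite !eqseq_cons; case: (ltgtP a b) => //= _; exact: IHu.
Qed.

Lemma lexle_head x0 u v : lexle u v -> size u = size v ->
  (head x0 u <= head x0 v)%O.
Proof.
case: u v => [|a u] [|b v] //=; rewrite /lexle eqseq_cons.
by case/orP=> [/andP[/eqP-> _]|/orP[/ltW|/andP[/eqP-> _]]].
Qed.

(** Equal lengths keep [u] from being a proper prefix of [v], so the comparison is settled before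
    the appended letter. *)
Lemma lexlt_rcons u v a : size u = size v -> lexlt u v ->
  lexlt (rcons u a) (rcons v a).
Proof.
elim: u v => [|b u IHu] [|c v] //= [suv].
by case/orP=> [->//|/andP[-> uv]]; rewrite IHu // orbT.
Qed.

End LexOrder.

(** * Commuting words and the conjugates of a primitive word *)

Section Primitive.
Context {d : Order.disp_t} {T : orderType d}.
Implicit Types u v w : seq T.

Lemma flatten_nseqD w a b :
  flatten (nseq (a + b) w) = flatten (nseq a w) ++ flatten (nseq b w).
Proof. by rewrite -flatten_cat nseqD. Qed.

(** Euclid's algorithm on lengths: the shorter word is a prefix of the longer one, and the remainder
    still commutes with it. *)
Lemma commuting_powers u v : u ++ v = v ++ u ->
  exists w a b, u = flatten (nseq a w) /\ v = flatten (nseq b w).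
Proof.
have [m] := ubnP (size u + size v); elim: m u v => // m IHm u v le_m.
wlog le_uv : u v le_m / size u <= size v => [hwlog|] uv.
  case/orP: (leq_total (size u) (size v)) => [/hwlog|le_vu]; first exact.
  have [||w [a [b [-> ->]]]] := hwlog v u _ le_vu => //; first by rewrite addnC.
  by exists w, b, a.
case: (posnP (size u)) => [/size0nil u0|u_gt0].
  by exists v, 0, 1; rewrite u0 /= cats0.
have [v' def_v] : exists v', v = u ++ v'.
  exists (drop (size u) v); have := congr1 (take (size u)) uv.
  by rewrite take_size_cat // takel_cat // => {1}->; rewrite cat_take_drop.
move: uv; rewrite def_v -catA => /eqP.
rewrite eqseq_cat // eqxx => /eqP /IHm[|w [a [b [def_u def_v']]]].
  by move: le_m; rewrite def_v size_cat; lia.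
by exists w, a, (a + b); rewrite flatten_nseqD -def_u -def_v'.
Qed.

Lemma primitive_rot_fixed v r : primitive v -> 0 < r < size v -> rot r v <> v.
Proof.
move=> prim_v /andP[r_gt0 lt_r] rot_v; apply: prim_v.
have /commuting_powers[w [a [b [def_u def_v]]]] :
    take r v ++ drop r v = drop r v ++ take r v by rewrite cat_take_drop.
(* The two parts of [v] are nonempty, so both exponents are positive and [a + b] is at least 2. *)
exists w, (a + b); rewrite flatten_nseqD -def_u -def_v cat_take_drop; split=> //.
have := congr1 size def_u; have := congr1 size def_v.
rewrite size_drop size_takel 1?ltnW // ltEnat /=.
by case: a b {def_u def_v} => [|a] [|b] /=; lia.
Qed.

Lemma conjugates_uniq v : primitive v -> uniq (conjugates v).
Proof.
move=> prim_v; rewrite map_inj_in_uniq ?iota_uniq // => i j.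
rewrite !mem_iota /= !add0n.
wlog lt_ij : i j / i < j => [hwlog|] lt_i lt_j eq_rot.
  case: (ltngtP i j) => // lt; first exact: hwlog.
  by apply/esym/hwlog.
case: (@primitive_rot_fixed v (j - i) prim_v); first lia.
apply: (@rot_inj i); rewrite -rotD ?subnKC 1?ltnW //.
Qed.

End Primitive.

(** * Position and length of the factors in a special factorization *)

Section Interleave.
Context {d : Order.disp_t} {T : orderType d}.

Lemma interleave_split x0 (bs : seq T) (qs : seq (seq T)) h :
  size qs = (size bs).-1 -> h < size qs ->
  exists u v, interleave bs qs = u ++ nth x0 bs h :: nth [::] qs h ++ nth x0 bs h.+1 :: v.
Proof.
elim: qs bs h => // q qs IHqs [|b bs] //= [|h] sz.
  case: bs sz => //= c bs sz _; exists [::].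
  by case: qs {IHqs} sz => [|q' qs] /=; eexists.
rewrite ltnS => lt_h; have [||u [v ->]] := IHqs bs h; [by case: bs sz => //= c bs []| by []|].
by exists (b :: q ++ u), v; rewrite /= catA.
Qed.

Lemma size_interleave (bs : seq T) (qs : seq (seq T)) :
  bs != [::] -> size qs = (size bs).-1 ->
  size (interleave bs qs) = (sumn [seq (size q).+1 | q <- qs]).+1.
Proof.
elim: qs bs => [|q qs IHqs] [|b bs] // _; first by case: bs.
move=> /= sz; have bs_n0 : bs != [::] by case: bs sz.
by rewrite size_cat IHqs -?sz // addnS addSn.
Qed.

End Interleave.

(** Strict growth from 0 gives [i <= U i]; strict growth up to [m - 1], where [U] is still below
    [m], gives [U i <= i]. *)
Lemma increasing_id (m : nat) (U : nat -> nat) :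
    (forall i, i < m -> U i < m) ->
    (forall i j, i < j -> j < m -> U i < U j) ->
  forall i, i < m -> U i = i.
Proof.
move=> U_lt U_mono i lt_im; apply/eqP; rewrite eqn_leq; apply/andP; split.
  suff /(_ (m.-1 - i)) : forall k, k < m - i -> U i + k <= U (i + k).
    by have := U_lt (i + (m.-1 - i)); lia.
  elim=> [|k IHk] lt_k; first by rewrite !addn0.
  by have := U_mono (i + k) (i + k.+1); have := IHk; lia.
elim: i lt_im => // i IHi lt_im; have := U_mono i i.+1; have := IHi; lia.
Qed.

(** * Rows of the Burrows-Wheeler matrix and their rotation *)

Section BurrowsWheeler.
Context {d : Order.disp_t} {T : orderType d} (x0 : T) (w : seq T).
Implicit Types (u v : seq T) (i j x : nat).

Definition row i : seq T := nth [::] (bwrows w) i.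
Definition first i : T := head x0 (row i).
Definition last_letter i : T := last x0 (row i).
(** For primitive [w] this is the inverse of the last-to-first map of the Burrows-Wheeler
    transform. *)
Definition step i : nat := index (rot 1 (row i)) (bwrows w).

Local Notation n := (size w).

Lemma size_bwrows : size (bwrows w) = n.
Proof. by rewrite size_sort size_map size_iota. Qed.

Lemma mem_bwrows u : (u \in bwrows w) = (u \in conjugates w).
Proof. exact: mem_sort. Qed.

Lemma conjugatesP u : 0 < n -> reflect (exists i, u = rot i w) (u \in conjugates w).
Proof.
move=> n_gt0; apply: (iffP mapP) => [[i _ ->]|[i ->]]; first by exists i.
case: (ltnP i n) => [lt_in|/rot_oversize->].
  by exists i; rewrite ?mem_iota.
by exists 0; rewrite ?rot0 ?mem_iota.
Qed.

Lemma rot_conjugates k u : u \in conjugates w -> rot k u \in conjugates w.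
Proof.
move=> uP; have n_gt0 : 0 < n by case/mapP: uP => i; rewrite mem_iota; lia.
case/(conjugatesP _ n_gt0): uP => i ->; apply/conjugatesP => //.
by exists (rot_add w i k); rewrite rot_rot_add.
Qed.

Lemma row_in i : i < n -> row i \in conjugates w.
Proof. by move=> lt_in; rewrite -mem_bwrows mem_nth ?size_bwrows. Qed.

Lemma conjugates_row u : u \in conjugates w -> exists2 i, i < n & row i = u.
Proof.
by rewrite -mem_bwrows => /(nthP [::])[i]; rewrite size_bwrows; exists i.
Qed.

Lemma size_conjugates u : u \in conjugates w -> size u = n.
Proof. by case/mapP=> i _ ->; rewrite size_rot. Qed.

Lemma size_row i : i < n -> size (row i) = n.
Proof. by move/row_in/size_conjugates. Qed.

Lemma step_lt i : i < n -> step i < n.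
Proof. by move=> /row_in/(rot_conjugates 1); rewrite -mem_bwrows -index_mem size_bwrows. Qed.

Lemma row_step i : i < n -> row (step i) = rot 1 (row i).
Proof. by move=> /row_in/(rot_conjugates 1); rewrite -mem_bwrows; apply: nth_index. Qed.

Lemma row_cons i : i < n -> exists v, row i = first i :: v.
Proof.
move=> lt_in; have := size_row lt_in; rewrite /first.
by case: (row i) => [|a v] /= ?; [lia | exists v].
Qed.

Lemma last_step i : i < n -> last_letter (step i) = first i.
Proof.
move=> lt_in; rewrite /last_letter row_step //.
by have [v ->] := row_cons lt_in; rewrite rot1_cons last_rcons.
Qed.

Lemma first_mono i j : i <= j -> j < n -> (first i <= first j)%O.
Proof.
move=> le_ij lt_jn; apply: lexle_head; last by rewrite !size_row //; lia.
apply: (sorted_leq_nth lexle_trans); rewrite ?inE ?size_bwrows //; last by lia.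
  by move=> u; rewrite /lexle eqxx.
exact: (sort_sorted lexle_total).
Qed.

Lemma iter_step_lt s i : i < n -> iter s step i < n.
Proof. by move=> lt_in; elim: s => //= s; apply: step_lt. Qed.

Lemma row_iter_step s i : i < n -> s <= n -> row (iter s step i) = rot s (row i).
Proof.
move=> lt_in; elim: s => [|s IHs] lt_sn; first by rewrite rot0.
by rewrite iterS row_step ?iter_step_lt // IHs 1?ltnW // -rotS ?size_row.
Qed.

Lemma nth_row s i : i < n -> s < n -> nth x0 (row i) s = first (iter s step i).
Proof.
move=> lt_in lt_sn; rewrite /first row_iter_step ?(ltnW lt_sn) //.
by rewrite /rot (drop_nth x0) ?size_row.
Qed.

Context (prim_w : primitive w).

Lemma primitive_size_gt0 : 0 < n.
Proof.
case: (posnP n) => // /size0nil w0.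
by case: prim_w; exists [::], 2; rewrite w0.
Qed.

Lemma row_inj i j : i < n -> j < n -> row i = row j -> i = j.
Proof.
move=> lt_in lt_jn /eqP; rewrite nth_uniq ?size_bwrows ?sort_uniq ?conjugates_uniq //.
by move/eqP.
Qed.

Lemma row_lt i j : i < j -> j < n -> lexlt (row i) (row j).
Proof.
move=> lt_ij lt_jn.
have := sorted_ltn_nth lexle_trans [::] (sort_sorted lexle_total (conjugates w)).
move/(_ i j); rewrite !inE !size_sort !size_map !size_iota => /(_ _ lt_jn lt_ij).
rewrite -/(bwrows w) -/(row i) -/(row j) => /(_ (ltn_trans lt_ij lt_jn)) /orP[]//.
by move/eqP/(row_inj (ltn_trans lt_ij lt_jn) lt_jn); lia.
Qed.

Lemma step_inj i j : i < n -> j < n -> step i = step j -> i = j.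
Proof.
move=> lt_in lt_jn /(congr1 row); rewrite !row_step //.
by move/rot_inj/row_inj; apply.
Qed.

Lemma step_surj j : j < n -> exists2 i, i < n & step i = j.
Proof.
move=> lt_jn; have /conjugates_row[i lt_in def_i] :
  rotr 1 (row j) \in conjugates w by apply/rot_conjugates/row_in.
exists i => //; apply: row_inj; rewrite ?step_lt //.
by rewrite row_step // def_i rotrK.
Qed.

(** Moving a common first letter to the end does not change how two words of equal length
    compare. *)
Lemma step_mono i j : i < j -> j < n -> first i = first j -> step i < step j.
Proof.
move=> lt_ij lt_jn eq_f; have lt_in := ltn_trans lt_ij lt_jn.
have : lexlt (row (step i)) (row (step j)).
  have := row_lt lt_ij lt_jn; rewrite !row_step //.
  have := size_row lt_in; have := size_row lt_jn.
  have [u ->] := row_cons lt_in; have [v ->] := row_cons lt_jn.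
  rewrite !rot1_cons eq_f /= ltxx eqxx /= => <- [?]; exact: lexlt_rcons.
rewrite ltnNge; apply: contraL; rewrite leq_eqVlt => /predU1P[->|lt_ji].
  by rewrite lexlt_irr.
apply/negP=> /lexlt_trans/(_ (row_lt lt_ji (step_lt lt_in))).
by rewrite lexlt_irr.
Qed.

Lemma iter_step_size i : i < n -> iter n step i = i.
Proof.
move=> lt_in; apply: row_inj; rewrite ?iter_step_lt //.
by rewrite row_iter_step // -(size_row lt_in) rot_size.
Qed.

(** * The interval exchange of a perfectly clustering word and its reversal symmetry *)

Context (clust_w : sorted (fun a b => (b <= a)%O) (bw w)).

Lemma bw_last : bw w = [seq last x0 u | u <- bwrows w].
Proof.
rewrite /bw; have : {subset bwrows w <= conjugates w}.
  by move=> u; rewrite mem_bwrows.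
elim: (bwrows w) => //= u s IHs sub_s.
have /size_conjugates : u \in conjugates w by rewrite sub_s ?mem_head.
rewrite -IHs => [|v sv]; last by rewrite sub_s // inE sv orbT.
case/lastP: u sub_s => [_|u a _ _]; last by rewrite rev_rcons last_rcons.
by have := primitive_size_gt0; rewrite /=; lia.
Qed.

Lemma last_anti i j : i <= j -> j < n -> (last_letter j <= last_letter i)%O.
Proof.
move=> le_ij lt_jn; have ge_trans : transitive (fun a b : T => (b <= a)%O).
  by move=> b a c ab bc; apply: le_trans bc ab.
have := sorted_leq_nth ge_trans (@lexx _ _) x0 clust_w.
move/(_ i j); rewrite bw_last !inE !size_map size_bwrows.
rewrite !(nth_map [::]) ?size_bwrows //; last by lia.
by apply; lia.
Qed.

Local Notation f := first.
Local Notation g := last_letter.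
Local Notation rho j := (n.-1 - j).

(** The first column is increasing, the last one decreasing, and they hold the same letters, so each
    is the other read upwards. *)
Lemma first_rho j : j < n -> f (rho j) = g j.
Proof.
move=> lt_jn; pose F := [seq head x0 u | u <- bwrows w].
pose G := [seq last x0 u | u <- bwrows w].
have F_nth i : i < n -> nth x0 F i = f i.
  by move=> lt_in; rewrite (nth_map [::]) ?size_bwrows.
have G_nth i : i < n -> nth x0 G i = g i.
  by move=> lt_in; rewrite (nth_map [::]) ?size_bwrows.
have sF : size F = n by rewrite size_map size_bwrows.
have sG : size G = n by rewrite size_map size_bwrows.
suff FG : F = rev G by rewrite -F_nth ?FG ?nth_rev ?sG -?G_nth; [congr nth|..]; lia.
have FE : F = [seq f i | i <- iota 0 n].
  apply: (@eq_from_nth _ x0) => [|i]; rewrite sF ?size_map ?size_iota // => lt_in.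
  by rewrite F_nth // (nth_map 0) ?size_iota // nth_iota.
have GE : G = [seq g i | i <- iota 0 n].
  apply: (@eq_from_nth _ x0) => [|i]; rewrite sG ?size_map ?size_iota // => lt_in.
  by rewrite G_nth // (nth_map 0) ?size_iota // nth_iota.
apply: (sorted_eq le_trans le_anti).
- rewrite FE; apply: (homo_sorted_in (P := gtn n)) (iota_sorted 0 n).
    by move=> i k ? ? ?; apply: first_mono.
  by apply/allP=> i; rewrite mem_iota.
- by rewrite rev_sorted /G -bw_last.
rewrite perm_sym perm_rev perm_sym FE GE.
(* Since [g \o step] agrees with [f] and [step] permutes the rows, the two columns are permutations
   of each other. *)
have /(perm_map g) : perm_eq [seq step i | i <- iota 0 n] (iota 0 n).
  have step_uniq : uniq [seq step i | i <- iota 0 n].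
    rewrite map_inj_in_uniq ?iota_uniq // => i k; rewrite !mem_iota.
    by move=> ? ?; apply: step_inj.
  apply: uniq_perm => //; first exact: iota_uniq.
  have [||] // := uniq_min_size step_uniq (s2 := iota 0 n); last by rewrite size_map.
  by move=> _ /mapP[i lt_i ->]; rewrite mem_iota in lt_i; rewrite mem_iota step_lt.
rewrite -map_comp; have /eq_in_map-> : {in iota 0 n, g \o step =1 f}.
  by move=> i; rewrite mem_iota; apply: last_step.
by [].
Qed.

(* The composite preserves the antitone function g and is increasing on its
   level sets, so it is increasing. *)
Lemma step_rho_step_rho j : j < n -> step (rho (step (rho j))) = j.
Proof.
have rho_lt i : i < n -> rho i < n by lia.
have g_stable i : i < n -> g (step (rho (step (rho i)))) = g i.
  move=> lt_in; have lt1 := step_lt (rho_lt _ lt_in).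
  by rewrite last_step ?rho_lt // first_rho // last_step ?rho_lt // first_rho.
move: j; apply: increasing_id => [i lt_in|i k lt_ik lt_kn].
  by do 2!rewrite ?step_lt ?rho_lt //.
have lt_in := ltn_trans lt_ik lt_kn.
have lt1 := step_lt (rho_lt _ lt_in); have lt2 := step_lt (rho_lt _ lt_kn).
have [eq_g|neq_g] := eqVneq (g i) (g k).
  have := @step_mono (rho k) (rho i); rewrite !first_rho // => /(_ _ _ (esym eq_g)).
  move=> lt12; apply: step_mono; rewrite ?first_rho ?last_step ?first_rho //; lia.
rewrite ltnNge; apply: contraNN neq_g => le_U.
have := last_anti le_U; rewrite !g_stable // => /(_ (step_lt (rho_lt _ lt1))) le_g.
by rewrite eq_le le_g (last_anti (ltnW lt_ik)).
Qed.

(** Reflection turns forward orbits into backward ones: the innermost [step], reflection, [step]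
    collapses to a reflection, [s] times over. *)
Lemma iter_step_rho s j : j < n -> iter s step (rho (iter s step j)) = rho j.
Proof.
have rho_lt i : i < n -> rho i < n by lia.
elim: s j => // s IHs j lt_jn; rewrite iterS iterSr IHs ?step_lt //.
by rewrite -[in RHS](step_rho_step_rho (rho_lt _ lt_jn)); congr (step (rho (step _))); lia.
Qed.

Lemma row_rho j : j < n -> row (rho j) = rev (row j).
Proof.
move=> lt_jn; have rho_lt i : i < n -> rho i < n by lia.
apply: (@eq_from_nth _ x0) => [|s]; rewrite size_row ?size_rev ?size_row ?rho_lt //.
move=> lt_sn; rewrite nth_rev ?size_row ?nth_row ?rho_lt //; last by lia.
(* This is the row reached from [j] by [s.+1] backward steps, as [step] has period [n]; its first
   letter is the letter of [row j] at position [n - s.+1]. *)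
set y := iter (n - s.+1) step j; have lt_yn : y < n by apply: iter_step_lt.
have def_j : j = iter s step (step y).
  by rewrite -iterSr /y -iterD subnKC // iter_step_size.
by rewrite [in LHS]def_j iter_step_rho ?step_lt // first_rho ?step_lt // last_step.
Qed.

(** A row landing strictly between the two images would end with the same letter, as the last column
    is monotone. Its preimage would then share the first letter of [i] and [i.+1] and lie strictly
    between them. *)
Lemma step_succ i : i.+1 < n -> f i = f i.+1 -> step i.+1 = (step i).+1.
Proof.
move=> lt_in eq_f; have lt_T := step_mono (ltnSn i) lt_in eq_f.
have lt_Tn := step_lt lt_in; apply/eqP; rewrite eqn_leq lt_T andbT leqNgt.
apply/negP=> lt2; have [c lt_cn def_c] := step_surj (ltn_trans lt2 lt_Tn).
have fc : f c = f i.
  apply: le_anti; rewrite {2}eq_f -!last_step ?(ltnW lt_in) // def_c.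
  apply/andP; split; apply: last_anti; lia.
have [lt_ci|lt_ic|eq_ic] := ltngtP c i.
- by have := step_mono lt_ci (ltnW lt_in) fc; rewrite def_c; lia.
- have [lt_ci1|lt_ic1|eq_ic] := ltngtP c i.+1; first lia.
    by have := step_mono lt_ic1 lt_cn; rewrite fc def_c => /(_ (esym eq_f)); lia.
  by move: def_c lt2; rewrite eq_ic; lia.
- by move: def_c; rewrite eq_ic; lia.
Qed.

Lemma step_shift i j : i <= j -> j < n -> f i = f j -> step j = step i + (j - i).
Proof.
move=> le_ij; rewrite -(subnKC le_ij); move: (j - i) => k.
elim: k => [|k IHk]; first by rewrite addn0 subnn addn0.
rewrite addnS => lt_n eq_f.
have eq_fk : f i = f (i + k).
  by apply: le_anti; rewrite {2}eq_f !first_mono //; lia.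
have := step_succ lt_n (etrans (esym eq_fk) eq_f).
by have := IHk (ltnW lt_n) eq_fk; lia.
Qed.

(** If the two extreme rows share their first [q] letters, so do all rows between, and the whole
    interval moves rigidly for [q] steps. *)
Lemma iter_step_shift q i j : j < n ->
    (forall s, s < q -> f (iter s step i) = f (iter s step j)) ->
  forall s x, s <= q -> i <= x -> x <= j -> iter s step x = iter s step i + (x - i).
Proof.
move=> lt_jn eq_f; elim=> [|s IHs] x lt_sq le_ix le_xj; first by rewrite subnKC.
have def_x := IHs x (ltnW lt_sq) le_ix le_xj.
have def_j := IHs j (ltnW lt_sq) (leq_trans le_ix le_xj) (leqnn j).
have lt_sj := iter_step_lt s lt_jn.
rewrite !iterS (@step_shift (iter s step i) (iter s step x)); try lia.
by apply: le_anti; rewrite {2}(eq_f _ lt_sq) !first_mono //; lia.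
Qed.

Lemma iter_step_inj s i j : i < n -> j < n ->
  iter s step i = iter s step j -> i = j.
Proof.
move=> lt_in lt_jn; elim: s => //= s IHs.
by move/step_inj => eq_s; apply: IHs; apply: eq_s; apply: iter_step_lt.
Qed.

(** * Orbits of adjacent rows attached to the palindromic factors *)

Context (l : seq T) (as_ : seq T) (ps : seq (seq T)).
Context (l_conj : l \in conjugates w).
Context (l_fact : palindromic_special_factorization l as_ ps).

Local Notation a h := (nth x0 as_ h).
Local Notation p h := (nth [::] ps h).

Lemma size_ps : size ps = (size as_).-1.
Proof. by case: l_fact => -[]. Qed.

Lemma size_as h : h < size ps -> h.+1 < size as_.
Proof. by rewrite size_ps; lia. Qed.

Lemma a_lt h k : k < size as_ -> h < k -> (a h < a k)%O.
Proof.
case: l_fact => -[_ as_sorted _ _ _] _ lt_k lt_hk.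
by rewrite lt_sorted_ltn_nth ?inE ?(ltn_trans lt_hk lt_k).
Qed.

Lemma mem_conjugate u : u \in conjugates w -> u =i w.
Proof. by case/mapP=> k _ -> b; rewrite mem_rot. Qed.

Lemma first_consecutive h i : h < size ps -> i < n ->
  (a h <= f i)%O -> (f i <= a h.+1)%O -> f i = a h \/ f i = a h.+1.
Proof.
case: l_fact => -[_ as_sorted memP _ _] _ /size_as lt_h lt_in le1 le2.
have : f i \in as_.
  rewrite -memP (mem_conjugate l_conj) -(mem_conjugate (row_in lt_in)).
  by have [v def_v] := row_cons lt_in; rewrite def_v mem_head.
case/(nthP x0)=> k lt_k def_k; rewrite -def_k in le1 le2 *.
rewrite !lt_sorted_leq_nth ?inE ?(ltnW lt_h) // in le1 le2.
by have [->|->] : k = h \/ k = h.+1; [lia|left|right].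
Qed.

Lemma factor_rows h : h < size ps -> exists i j v,
  [/\ i < n, j < n, row i = p h ++ a h :: rcons (rev v) (a h.+1)
    & row j = p h ++ a h.+1 :: rcons v (a h)].
Proof.
case: l_fact => -[_ _ _ sz def_l] /allP pal lt_h.
have [u [v def_uv]] := interleave_split x0 sz lt_h.
have := rot_conjugates (size u).+1 l_conj.
rewrite def_l def_uv -cat_rcons -(size_rcons u (a h)) rot_size_cat.
case/conjugates_row=> j lt_jn def_j.
have lt_k := iter_step_lt (size (p h)) lt_jn; have := row_rho lt_k.
have le_pn : size (p h) <= n by rewrite -(size_row lt_jn) def_j !size_cat; lia.
rewrite row_iter_step // def_j -catA rot_size_cat !rev_cat rev_rcons rev_cons.
rewrite -(eqP (pal _ (mem_nth [::] lt_h))) => def_i.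
(* Row [j] is the rotation of [l] starting at the factor. Rotating the factor to the end and
   reversing brings it back to the front, since it is a palindrome; this gives row [i]. *)
exists (rho (iter (size (p h)) step j)), j, (v ++ u).
rewrite def_j def_i rcons_cat /= -rcons_cat -rev_cat; split=> //; first lia.
by rewrite -catA.
Qed.

(* The row just above the block of rows that end with [a h]. *)
Definition cut h : nat := (find (fun i => g i == a h) (iota 0 n)).-1.

Lemma cutP h : h < size ps ->
  [/\ (cut h).+1 < n, g (cut h) = a h.+1 & g (cut h).+1 = a h] /\
  [/\ forall s, s <= size (p h) -> iter s step (cut h).+1 = (iter s step (cut h)).+1,
      forall s, s < size (p h) -> f (iter s step (cut h)) = nth x0 (p h) s,
      forall s, s < size (p h) -> f (iter s step (cut h).+1) = nth x0 (p h) s,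
      (a h <= f (iter (size (p h)) step (cut h)))%O
    & (f (iter (size (p h)) step (cut h).+1) <= a h.+1)%O].
Proof.
move=> lt_h; have [i [j [v [lt_in lt_jn def_i def_j]]]] := factor_rows lt_h.
have lt_a := a_lt (size_as lt_h) (ltnSn h).
have lt_pn : size (p h) < n by rewrite -(size_row lt_in) def_i size_cat /=; lia.
have g_i : g i = a h.+1 by rewrite /last_letter def_i last_cat /= last_rcons.
have g_j : g j = a h by rewrite /last_letter def_j last_cat /= last_rcons.
have f_i s : s < size (p h) -> f (iter s step i) = nth x0 (p h) s.
  by move=> lt_s; rewrite -nth_row ?def_i ?nth_cat ?lt_s //; lia.
have f_j s : s < size (p h) -> f (iter s step j) = nth x0 (p h) s.
  by move=> lt_s; rewrite -nth_row ?def_j ?nth_cat ?lt_s //; lia.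
have f_i_end : f (iter (size (p h)) step i) = a h.
  by rewrite -nth_row // def_i nth_cat ltnn subnn.
have f_j_end : f (iter (size (p h)) step j) = a h.+1.
  by rewrite -nth_row // def_j nth_cat ltnn subnn.
rewrite /cut; set P := (fun i => g i == a h); set m := find _ _.
have has_m : has P (iota 0 n).
  by apply/hasP; exists j; rewrite ?mem_iota // /P g_j.
have lt_mn : m < n by rewrite -[X in _ < X](size_iota 0) -has_find.
have g_m : g m = a h by have := nth_find 0 has_m; rewrite nth_iota // => /eqP.
have before_m k : k < m -> g k != a h.
  move=> lt_km; have := before_find 0 lt_km.
  by rewrite nth_iota ?(ltn_trans lt_km) // /P => ->.
have le_mj : m <= j.
  by rewrite leqNgt; apply/negP=> /before_m; rewrite g_j eqxx.
have lt_im : i < m.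
  rewrite ltnNge; apply/negP=> le_mi; have := last_anti le_mi lt_in.
  by rewrite g_i g_m leNgt lt_a.
have [c def_m] : exists c, m = c.+1 by exists m.-1; lia.
rewrite def_m /=; rewrite {}def_m in lt_mn g_m before_m le_mj lt_im.
have le_ic : i <= c by [].
(* The last letter of [c] is squeezed between two consecutive letters and is not [a h], by
   minimality of [c.+1]. Reflection turns it into a first letter, as [first_consecutive]
   requires. *)
have g_c : g c = a h.+1.
  have lt_cn := ltnW lt_mn.
  have le_a : (a h <= f (rho c))%O by rewrite first_rho // -g_m last_anti.
  have ge_a : (f (rho c) <= a h.+1)%O by rewrite first_rho // -g_i last_anti.
  have lt_rho : rho c < n by lia.
  rewrite -first_rho //; case: (first_consecutive lt_h lt_rho le_a ge_a) => // /eqP.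
  by rewrite first_rho // (negPf (before_m c (ltnSn c))).
have shift := @iter_step_shift (size (p h)) i j lt_jn.
have {}shift : forall s x, s <= size (p h) -> i <= x -> x <= j ->
    iter s step x = iter s step i + (x - i).
  by apply: shift => s lt_s; rewrite f_i ?f_j.
have f_between s x : s < size (p h) -> i <= x -> x <= j ->
    f (iter s step x) = nth x0 (p h) s.
  move=> lt_s le_ix le_xj; rewrite -(f_i s lt_s); apply: le_anti.
  rewrite {1}(f_i s lt_s) -{1}(f_j s lt_s).
  have def_x := shift s x (ltnW lt_s) le_ix le_xj.
  have shift_j := shift s j (ltnW lt_s) (leq_trans le_ix le_xj) (leqnn j).
  have lt_sj := iter_step_lt s lt_jn.
  by rewrite !first_mono //; lia.
have end_c := shift (size (p h)) c (leqnn _) le_ic (ltnW le_mj).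
have end_j := shift (size (p h)) j (leqnn _) (leq_trans le_ic (ltnW le_mj)) (leqnn j).
have end_m := shift (size (p h)) c.+1 (leqnn _) (leqW le_ic) le_mj.
have lt_end := iter_step_lt (size (p h)) lt_jn.
split; split=> //.
- move=> s le_s; rewrite (shift s c.+1) ?(leqW le_ic) //.
  by rewrite (shift s c) ?(ltnW le_mj) //; lia.
- by move=> s lt_s; rewrite f_between // ltnW.
- by move=> s lt_s; rewrite f_between // leqW.
- by rewrite -[X in (X <= _)%O]f_i_end first_mono //; lia.
- by rewrite -[X in (_ <= X)%O]f_j_end first_mono //; lia.
Qed.

(** A pair of rows at a cut has distinct last letters, whereas a pair reached by at least one step
    along a factor has equal ones; so no cut lies further along an orbit. *)
Lemma cut_orbits_disjoint h s k t : h < size ps -> k < size ps ->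
    s <= size (p h) -> t <= size (p k) ->
  iter s step (cut h) = iter t step (cut k) -> h = k /\ s = t.
Proof.
wlog le_st : h s k t / s <= t => [hwlog|] lt_h lt_k le_s le_t eq_st.
  case/orP: (leq_total s t) => le; first exact: hwlog.
  by have [||||||-> ->] := hwlog k t h s.
have [[lt_ch g_h g_h1] _] := cutP lt_h.
have [[lt_ck _ g_k1] [succ_k f_k f_k1 _ _]] := cutP lt_k.
move: eq_st le_t; rewrite -(subnKC le_st) iterD.
move/(iter_step_inj (ltnW lt_ch) (iter_step_lt _ (ltnW lt_ck))).
(* With no steps left the cuts coincide, and the last letter just below them identifies [h] with
   [k]. *)
case: (t - s) => [|r] eq_c le_r.
  split; last by rewrite addn0.
  move: g_h1; rewrite eq_c g_k1 => /eqP; rewrite nth_uniq ?(ltnW (size_as _)) //.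
    by move/eqP.
  by case: l_fact => -[_ /lt_sorted_uniq].
have lt_r : r < size (p k) by lia.
move: g_h1 g_h; rewrite eq_c -succ_k // !iterS.
rewrite !last_step ?iter_step_lt // 1?ltnW // f_k // f_k1 // => -> eq_a.
by have := a_lt (size_as lt_h) (ltnSn h); rewrite eq_a ltxx.
Qed.

(** By counting: each factor contributes its length plus one, which sums to [n.-1], the number of
    adjacent pairs. *)
Lemma cut_orbits_cover j : j.+1 < n ->
  exists h s, [/\ h < size ps, s <= size (p h) & iter s step (cut h) = j].
Proof.
move=> lt_jn; pose E := [seq iter s step (cut h) | h <- iota 0 (size ps),
                                             s <- iota 0 (size (p h)).+1].
have memE i : i \in E -> exists h s,
    [/\ h < size ps, s <= size (p h) & i = iter s step (cut h)].
  by case/allpairsPdep=> h [s []]; rewrite !mem_iota => ? ? ->; exists h, s.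
have uniqE : uniq E.
  apply: allpairs_uniq_dep => [|h _|]; rewrite ?iota_uniq //.
  move=> _ _ /allpairsPdep[h [s [hP sP ->]]] /allpairsPdep[k [t [kP tP ->]]] /=.
  rewrite !mem_iota /= !add0n in hP sP kP tP.
  by case/cut_orbits_disjoint=> // -> ->.
have sizeE : size E = n.-1.
  rewrite size_allpairs_dep; have -> : n = size l by rewrite (size_conjugates l_conj).
  case: l_fact => -[as_n0 _ _ sz ->] _; rewrite size_interleave //=; congr sumn.
  rewrite -[in RHS](mkseq_nth [::] ps) /mkseq -map_comp.
  by apply: eq_map => h /=; rewrite size_iota.
have subE : {subset E <= iota 0 n.-1}.
  move=> _ /memE[h [s [lt_h le_s ->]]]; have [[lt_c _ _] [succ _ _ _ _]] := cutP lt_h.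
  by have := iter_step_lt s lt_c; rewrite succ // mem_iota; lia.
have [|_ /(_ j)] := uniq_min_size uniqE subE; first by rewrite size_iota sizeE.
rewrite mem_iota; have -> : (0 <= j < 0 + n.-1) by lia.
by case/memE=> h [s [? ? ->]]; exists h, s.
Qed.

Lemma cut_orbit_end h : h < size ps ->
  rho (cut h) = iter (size (p h)) step (cut h).+1.
Proof.
move=> lt_h; have [[lt_c g_c g_c1] [succ _ _ f_ge f_le]] := cutP lt_h.
rewrite succ //; move: f_ge f_le; rewrite succ //; set e := iter _ _ _ => f_ge f_le.
have lt_e : e.+1 < n by rewrite -succ // iter_step_lt.
(* Otherwise the images of [e] and [e.+1] are adjacent, hence covered by an orbit. They are not at a
   cut, since their last letters agree; so [e] would precede them on that orbit, which must be that
   of [h], beyond its end. *)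
have neq_f : f e != f e.+1.
  apply/eqP=> eq_f; have lt_Te := step_lt lt_e; rewrite (step_succ lt_e eq_f) in lt_Te.
  have [k [[|s] [lt_k le_s def_s]]] := cut_orbits_cover lt_Te.
    have [[_ g_k g_k1] _] := cutP lt_k.
    rewrite /= in def_s; move: g_k g_k1; rewrite def_s -step_succ // !last_step // 1?ltnW //.
    rewrite -eq_f => -> eq_a.
    by have := a_lt (size_as lt_k) (ltnSn k); rewrite eq_a ltxx.
  move: def_s; rewrite iterS => /step_inj eq_e.
  have [[lt_ck _ _] _] := cutP lt_k.
  have {}eq_e := eq_e (iter_step_lt s (ltnW lt_ck)) (ltnW lt_e).
  have [||||eq_k eq_s] := cut_orbits_disjoint _ _ _ _ eq_e => //; first exact: ltnW.
  by move: le_s; rewrite eq_k eq_s ltnn.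
have lt_f : (f e < f e.+1)%O by rewrite lt_neqAle neq_f first_mono.
have lt_a := a_lt (size_as lt_h) (ltnSn h).
have f_e : f e = a h.
  case: (first_consecutive lt_h (ltnW lt_e) f_ge) => //.
    by rewrite (le_trans (ltW lt_f)).
  by move=> eq_f; move: lt_f; rewrite eq_f ltNge f_le.
have f_e1 : f e.+1 = a h.+1.
  case: (first_consecutive lt_h lt_e _ f_le) => //.
    by rewrite (le_trans f_ge) ?ltW.
  by move=> eq_f; move: lt_f; rewrite eq_f f_e ltxx.
have f_r : f (rho (cut h)) = a h.+1 by rewrite first_rho // ltnW.
have f_r1 : f (rho (cut h).+1) = a h by rewrite first_rho.
(* Rows beginning with [a h] lie above those beginning with [a h.+1]. Both adjacent pairs, [e] with
   [e.+1] and the reflected cut, straddle this boundary, so they coincide. *)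
have jump i k : i < n -> k < n -> f i = a h -> f k = a h.+1 -> i < k.
  move=> lt_i lt_k f_i f_k; rewrite ltnNge; apply/negP=> le_ki.
  by have := first_mono le_ki lt_i; rewrite f_i f_k leNgt lt_a.
have := jump _ _ (ltnW lt_e) _ f_e f_r; have := jump _ _ _ lt_e f_r1 f_e1.
by lia.
Qed.

Lemma consecutive_rows j : j.+1 < n ->
  exists x y m : seq T,
    [/\ row j = y ++ m ++ x, row j.+1 = y ++ rev m ++ x & x ++ y \in ps].
Proof.
case/cut_orbits_cover=> h [s [lt_h le_s def_j]].
have [[lt_c _ _] [succ f_c f_c1 _ _]] := cutP lt_h.
have lt_pn : size (p h) <= n.
  have [i [_ [v [lt_in _ def_i _]]]] := factor_rows lt_h.
  by rewrite -(size_row lt_in) def_i size_cat leq_addr.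
have split_row i : i < n -> (forall t, t < size (p h) -> f (iter t step i) = nth x0 (p h) t) ->
    exists v, row i = p h ++ v.
  move=> lt_i f_i; exists (drop (size (p h)) (row i)).
  rewrite -[LHS](cat_take_drop (size (p h))); congr (_ ++ _).
  have sz : size (take (size (p h)) (row i)) = size (p h) by rewrite size_takel ?size_row.
  apply: (@eq_from_nth _ x0); rewrite sz // => t lt_t.
  by rewrite nth_take // nth_row ?f_i //; lia.
have [z def_z] := split_row _ (ltnW lt_c) f_c.
have [z' def_z'] := split_row _ lt_c f_c1.
(* The reflected cut is computed twice: as the reversal of [p h ++ z], and as the rotation of
   [p h ++ z'] past the factor. Both end with the palindrome [p h], which cancels. *)
have rev_z : z' = rev z.
  have := row_rho (ltnW lt_c); rewrite cut_orbit_end // row_iter_step // def_z' def_z.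
  have [_ /allP pal] := l_fact.
  rewrite rot_size_cat rev_cat -(eqP (pal _ (mem_nth [::] lt_h))) => /eqP.
  rewrite eqseq_cat => [/andP[/eqP]//|]; apply: (@addnI (size (p h))).
  by rewrite size_rev -!size_cat -def_z -def_z' !size_row // ltnW.
(* After [s] steps the first [s] letters of the factor have moved to the end of both rows. *)
exists (take s (p h)), (drop s (p h)), z.
have rot_s v : rot s (p h ++ v) = drop s (p h) ++ v ++ take s (p h).
  by rewrite /rot take_cat drop_cat; case: ltngtP le_s => // [|->] _;
     rewrite ?subnn ?take0 ?drop0 ?cats0 ?take_size ?drop_size ?catA.
have le_sn := leq_trans le_s lt_pn.
split; last by rewrite cat_take_drop mem_nth.
- by rewrite -def_j (row_iter_step (ltnW lt_c)) // def_z.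
- by rewrite -def_j -succ // row_iter_step // def_z' rev_z.
Qed.

End BurrowsWheeler.

Theorem theorem6p2 (d : Order.disp_t) (T : orderType d) (w : seq T)
    (l : seq T) (as_ : seq T) (ps : seq (seq T)) :
  perfectly_clustering w ->
  l \in conjugates w -> lyndon l ->
  palindromic_special_factorization l as_ ps ->
  forall j : nat, j.+1 < size w ->
  exists x y m : seq T,
    [/\ nth [::] (bwrows w) j = y ++ m ++ x,
        nth [::] (bwrows w) j.+1 = y ++ rev m ++ x
      & x ++ y \in ps].
Proof.
move=> [prim_w clust_w] l_conj _ l_fact j lt_jn.
(* Any letter of [w] serves as the default value for reading the columns. *)
have [x0 _] : exists x0 : T, x0 \in w.
  by case: (w) lt_jn => // a v; exists a; apply: mem_head.
exact: (consecutive_rows x0 prim_w clust_w l_conj l_fact).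
Qed.
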